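(* Let $r\ge 2$ and let $G=K(1,\ldots,1,2)$ be the complete $(r+1)$-partite graph with $r$ parts of size $1$ and one part of size $2$ (equivalently, $K_{r+2}$ with one edge deleted), of order $r+2\ge 4$. Then $G$ is $k$-super graceful if and only if $r=2$ and $k=1$.
   Context: For integers $a\le b$, $[a,b]$ is the set of integers between $a$ and $b$ inclusive. For $k\ge 1$, a $k$-super graceful labeling of a graph $G=(V,E)$ with $p$ vertices and $q$ edges is a bijection $f:V\cup E\to[k,k+p+q-1]$ with $f(uv)=|f(u)-f(v)|$ for every edge $uv$; $G$ is $k$-super graceful if it admits one. *)

(* Defs.v *)
From HB Require Import structures.
From mathcomp Require Import all_boot all_order all_algebra.

Set Implicit Arguments.
Unset Strict Implicit.
Unset Printing Implicit Defensive.

Record sgraph := SGraph {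
  vertex : finType;
  adj : rel vertex;
  adj_sym : symmetric adj;
  adj_irr : irreflexive adj
}.

Definition edges (G : sgraph) : {set {set vertex G}} :=
  [set [set u; v] | u in vertex G, v in vertex G & adj u v].

Definition edge (G : sgraph) : Type := {A : {set vertex G} | A \in edges G}.

Definition gorder (G : sgraph) : nat := #|vertex G|.
Definition gsize (G : sgraph) : nat := #|edges G|.

Definition nat_interval (a b : nat) : Type := {n : nat | a <= n <= b}.

(* V \cup E is rendered as the disjoint sum of vertices and edges; [val] reads
   a label back as a natural number.  For k >= 1 the truncated subtraction
   k + p + q - 1 is the usual one. *)
Definition is_super_graceful_labeling (k : nat) (G : sgraph)
    (f : vertex G + edge G -> nat_interval k (k + gorder G + gsize G - 1)) : Prop :=
  bijective f /\
  forall (u v : vertex G) (e : edge G), val e = [set u; v] ->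
    val (f (inr e)) = `|val (f (inl u)) - val (f (inl v))|%N.

Definition super_graceful (k : nat) (G : sgraph) : Prop :=
  exists f : vertex G + edge G -> nat_interval k (k + gorder G + gsize G - 1),
    is_super_graceful_labeling f.

(* In the complete multipartite graph with part sizes s_0, ..., s_(m-1), a
   vertex is a pair of a part i < m and an element of 'I_(s_i). *)
Definition mpart_vertex (s : seq nat) : finType :=
  {i : 'I_(size s) & 'I_(nth 0 s i)}.

Definition mpart_adj (s : seq nat) : rel (mpart_vertex s) :=
  fun x y => tag x != tag y.

Lemma mpart_adj_sym (s : seq nat) : symmetric (@mpart_adj s).
Proof. by move=> x y; rewrite /mpart_adj eq_sym. Qed.

Lemma mpart_adj_irr (s : seq nat) : irreflexive (@mpart_adj s).
Proof. by move=> x; rewrite /mpart_adj eqxx. Qed.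

Definition complete_multipartite (s : seq nat) : sgraph :=
  SGraph (@mpart_adj_sym s) (@mpart_adj_irr s).

(* Main.v *)
Require Import Defs.
From HB Require Import structures.
From mathcomp Require Import all_boot all_order all_algebra.
From mathcomp Require Import zify.

Set Implicit Arguments.
Unset Strict Implicit.
Unset Printing Implicit Defensive.

(** Let M be the largest label.  A difference of two labels is at most M - k, so
    M, M - 1, ..., M - k + 1 are vertex labels.  For k >= 2 this forces M - 1 and M to be the two non-adjacent
    vertices, and following the labels M - 2, ..., M - 5 downwards gives a
    contradiction.  For k = 1, adding a mark 0 to the vertex labels gives a ruler
    on which every distance 1, ..., M is measured and all coincidences of
    distances involve one single pair of marks.  Up to reflection 1 is a mark, and
    determining how M - 2, ..., M - 7 are measured excludes every such ruler of
    length at least 14, that is, r >= 3.  For r = 2 the vertex labels 1, 2, 6, 9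
    work, with 1 and 2 non-adjacent. *)

(** * Rulers with one repeated distance *)

(** [b + c = a + d] expresses [b - a = d - c] without truncated subtraction; for equal distances,
    [a <> c] says that the two pairs of marks differ. *)
Definition repeats_only (B : pred nat) (x y : nat) : Prop :=
  forall a b c d, B a -> B b -> B c -> B d -> a < b -> c < d -> a <> c ->
    b + c = a + d -> (a = x /\ b = y) \/ (c = x /\ d = y).

Definition measures_upto (B : pred nat) (M : nat) : Prop :=
  forall l, 0 < l <= M -> exists u v, [/\ B u, B v, v <= M & v = u + l].

(** Each coincidence must contain the pair [(x, y)], so the two would share a pair, which the last
    four conditions forbid. *)
Lemma disjoint_repeats_absurd B x y a b c d a' b' c' d' :
  repeats_only B x y ->
  B a -> B b -> B c -> B d -> B a' -> B b' -> B c' -> B d' ->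
  [/\ a < b, c < d, a <> c & b + c = a + d] ->
  [/\ a' < b', c' < d', a' <> c' & b' + c' = a' + d'] ->
  [/\ a <> a' \/ b <> b', a <> c' \/ b <> d',
      c <> a' \/ d <> b' & c <> c' \/ d <> d'] -> False.
Proof.
move=> rep Ba Bb Bc Bd Ba' Bb' Bc' Bd' [ab cd ac e] [ab' cd' ac' e'] [n1 n2 n3 n4].
have := rep _ _ _ _ Ba Bb Bc Bd ab cd ac e.
have := rep _ _ _ _ Ba' Bb' Bc' Bd' ab' cd' ac' e'.
clear -n1 n2 n3 n4; lia.
Qed.

(** A distance [M - d] fits below [M] only from a mark [i <= d] to [M - (d - i)]. The boolean form
    expands into [d + 1] cases that known marks and non-marks simplify. *)
Lemma measures_upto_near_max B M d : measures_upto B M -> d < M ->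
  has (fun i => B i && B (M - (d - i))) (iota 0 d.+1).
Proof.
move=> cov ltdM; have [|u [v [Bu Bv vM e]]] := cov (M - d); first lia.
apply/hasP; exists u; first by rewrite mem_iota; lia.
by rewrite Bu /= (_ : M - (d - u) = v) //; lia.
Qed.

(** Without the bound [n <= M], truncated subtraction would send every larger [n] to [0]. *)
Definition mirror (M : nat) (B : pred nat) : pred nat :=
  fun n => (n <= M) && B (M - n).

Lemma repeats_only_mirror M B x y : y <= M -> repeats_only B x y ->
  repeats_only (mirror M B) (M - y) (M - x).
Proof.
move=> yM rep a b c d /andP[aM Ba] /andP[bM Bb] /andP[cM Bc] /andP[dM Bd] ab cd ac e.
by case: (rep _ _ _ _ Bb Ba Bd Bc) => [||||[? ?]|[? ?]]; lia.
Qed.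

Lemma measures_upto_mirror M B :
  measures_upto B M -> measures_upto (mirror M B) M.
Proof.
move=> cov l /cov[u [v [Bu Bv vM e]]]; exists (M - v), (M - u).
rewrite /mirror !subKn; try lia.
by split=> //; try lia; apply/andP; split=> //; lia.
Qed.

(* Two coincidences of distances without a common pair of marks:
   (a, b) ~ (c, d) and (a', b') ~ (c', d'). *)
Ltac clash H leM a b c d a' b' c' d' :=
  exfalso; apply: (H a b c d a' b' c' d'); (assumption || (clear -leM; split; lia)).

(** A candidate mark near either end is excluded when it completes two coincidences without a common
    pair. The long distances then force the surviving candidates, until one distance cannot be
    measured. *)
Lemma no_ruler_with_one B M x y : 14 <= M -> repeats_only B x y ->
  measures_upto B M -> B 0 -> B M -> B 1 -> False.
Proof.
move=> leM rep cov B0 BM B1.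
have clash := disjoint_repeats_absurd rep.
have near d (ltd : d < 14) := measures_upto_near_max cov (leq_trans ltd leM).
have nM1 : B (M - 1) = false.
  by apply/negP => ?; clash clash leM 0 1 (M - 1) M 0 (M - 1) 1 M.
have := near 2 isT.
rewrite /= !subSS !subn0 B0 B1 BM nM1 /= ?(andbT, orbF, andbF, orFb).
(* With [M - 1] excluded, the distance [M - 2] runs from [2] to [M] or from [0] to [M - 2]. *)
have [B2 _|nB2 /= BM2] := boolP (B 2).
  (* The equal gaps [(0, 1)] and [(1, 2)] form a coincidence, so any coincidence using neither of
     them is a clash. *)
  have nM2 : B (M - 2) = false.
    by apply/negP => ?; clash clash leM 0 1 1 2 0 (M - 2) 2 M.
  have n3 : B 3 = false.
    by apply/negP => ?; clash clash leM 0 1 1 2 0 2 1 3.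
  have := near 3 isT.
  rewrite /= !subSS !subn0 B0 B1 B2 n3 nM1 nM2 /= ?(andbT, orbF, andbF, orFb) => BM3.
  have n4 : B 4 = false.
    by apply/negP => ?; clash clash leM 0 1 1 2 0 2 2 4.
  have nM4 : B (M - 4) = false.
    by apply/negP => ?; clash clash leM 0 1 1 2 0 (M - 4) 1 (M - 3).
  have n5 : B 5 = false.
    by apply/negP => ?; clash clash leM 0 1 1 2 2 5 (M - 3) M.
  have nM5 : B (M - 5) = false.
    by apply/negP => ?; clash clash leM 0 1 1 2 0 (M - 5) 2 (M - 3).
  have nM6 : B (M - 6) = false.
    by apply/negP => ?; clash clash leM 0 1 1 2 (M - 6) (M - 3) (M - 3) M.
  have := near 6 isT.
  rewrite /= !subSS !subn0 n3 n4 n5 nM1 nM4 nM5 nM6 BM /= ?(andbT, orbF, andbF, orFb) => B6.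
  have n7 : B 7 = false.
    by apply/negP => ?; clash clash leM 0 1 1 2 0 6 1 7.
  have nM7 : B (M - 7) = false.
    by apply/negP => ?; clash clash leM 0 1 1 2 2 6 (M - 7) (M - 3).
  have := near 7 isT.
  by rewrite /= !subSS !subn0 n3 n4 n5 n7 nM1 nM4 nM5 nM6 nM7 /= ?(andbF, orbF).
move/negbTE: nB2 => n2.
have {}BM2 : B (M - 2) by move: BM2; rewrite ?orbF.
have n3 : B 3 = false.
  by apply/negP => ?; clash clash leM 3 M 1 (M - 2) 1 3 (M - 2) M.
have nM3 : B (M - 3) = false.
  by apply/negP => ?; clash clash leM 0 (M - 3) 1 (M - 2) (M - 3) (M - 2) 0 1.
(* The distance [M - 3] is measured from [1] to [M - 2] and forces nothing; [M - 4] forces [M - 4]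
   or [4] to be a mark. *)
have := near 4 isT.
rewrite /= !subSS !subn0 B0 B1 n2 n3 nM1 nM3 BM /= ?(andbT, orbF, andbF, orFb).
have [BM4 _|nBM4 /= B4] := boolP (B (M - 4)).
  (* Here the equal gaps between [M - 4], [M - 2] and [M] are the coincidence to clash with. *)
  have n4 : B 4 = false.
    by apply/negP => ?; clash clash leM (M - 4) (M - 2) (M - 2) M 0 4 (M - 4) M.
  have n5 : B 5 = false.
    by apply/negP => ?; clash clash leM (M - 4) (M - 2) (M - 2) M 5 M 1 (M - 4).
  have nM5 : B (M - 5) = false.
    by apply/negP => ?; clash clash leM (M - 4) (M - 2) (M - 2) M 0 (M - 5) 1 (M - 4).
  have nM6 : B (M - 6) = false.
    by apply/negP => ?; clash clash leM (M - 4) (M - 2) (M - 2) M (M - 6) (M - 2) (M - 4) M.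
  have := near 6 isT.
  rewrite /= !subSS !subn0 n2 n3 n4 n5 nM1 nM5 nM6 BM /= ?(andbT, orbF, andbF, orFb) => B6.
  have n7 : B 7 = false.
    by apply/negP => ?; clash clash leM (M - 4) (M - 2) (M - 2) M 6 7 0 1.
  have nM7 : B (M - 7) = false.
    by apply/negP => ?; clash clash leM (M - 4) (M - 2) (M - 2) M (M - 7) (M - 2) 1 6.
  have := near 7 isT.
  by rewrite /= !subSS !subn0 n2 n3 n4 n5 n7 nM1 nM3 nM5 nM6 nM7 /= ?(andbF, orbF).
move/negbTE: nBM4 => nM4.
have {}B4 : B 4 by move: B4; rewrite ?orbF.
have n5 : B 5 = false.
  by apply/negP => ?; clash clash leM 4 5 0 1 1 5 0 4.
have nM5 : B (M - 5) = false.
  by apply/negP => ?; clash clash leM (M - 5) (M - 2) 1 4 1 (M - 5) 4 (M - 2).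
have := near 5 isT.
by rewrite /= !subSS !subn0 n2 n3 n5 nM1 nM3 nM4 nM5 /= ?(andbF, orbF).
Qed.

(** The distance [M - 1] makes [1] or [M - 1] a mark, and reflection reduces the second case to the
    first. *)
Lemma no_ruler_repeating_once B M x y : 14 <= M -> y <= M ->
  repeats_only B x y -> measures_upto B M -> B 0 -> B M -> False.
Proof.
move=> leM yM rep cov B0 BM.
have /(measures_upto_near_max cov) : 1 < M by lia.
rewrite /= subnn !subn0 B0 BM /= andbT orbF => /orP[BM1|B1].
  apply: (@no_ruler_with_one (mirror M B) M (M - y) (M - x)) => //.
  - exact: repeats_only_mirror.
  - exact: measures_upto_mirror.
  - by rewrite /mirror subn0 BM.
  - by rewrite /mirror subnn B0 leqnn.
  - by rewrite /mirror BM1 andbT; lia.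
exact: (no_ruler_with_one leM rep cov).
Qed.

(** * Label sets *)

(* [A] is the set of vertex labels, and [x], [y] are the labels of the only two
   non-adjacent vertices. *)
Record label_set (k M x y : nat) (A : pred nat) : Prop := LabelSet {
  label_range : forall n, A n -> k <= n <= M;
  label_edge_min : forall u v, A u -> A v -> u < v -> ~ (u = x /\ v = y) ->
    k <= v - u;
  label_edge_new : forall u v, A u -> A v -> u < v -> ~ (u = x /\ v = y) ->
    ~ A (v - u);
  label_edge_inj : forall u v u' v', A u -> A v -> u < v -> ~ (u = x /\ v = y) ->
    A u' -> A v' -> u' < v' -> ~ (u' = x /\ v' = y) ->
    v - u = v' - u' -> u = u' /\ v = v';
  label_onto : forall l, k <= l <= M ->
    A l \/ exists u v, [/\ A u, A v, u < v, ~ (u = x /\ v = y) & v = u + l]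
}.

Lemma nat_pair_eqP (a b x y : nat) : a = x /\ b = y \/ ~ (a = x /\ b = y).
Proof. lia. Qed.

Lemma label_max k M x y A : 1 <= k <= M -> label_set k M x y A -> A M.
Proof.
move=> kM [rng _ _ _ onto].
have [|//|[u [v [/rng Au /rng Av _ _]]]] := onto M; lia.
Qed.

Lemma label_set_k1 k M x y A : 1 <= k -> k + 8 <= M ->
  label_set k M x y A -> k = 1.
Proof.
move=> k1 kM lA; have AM : A M by apply: label_max lA; lia.
case: lA => rng emin enew einj onto.
apply/eqP; rewrite eqn_leq k1 andbT leqNgt; apply/negP => k2.
have AM1 : A (M - 1).
  by have [|//|[u [v [/rng Au /rng Av _ _]]]] := onto (M - 1); lia.
have [ex ey] : x = M - 1 /\ y = M.
  (* Labels at distance [1 < k] cannot be adjacent, so [M - 1] and [M] are the exceptional pair and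
     no other two vertex labels are consecutive. *)
  have [//|ne] := nat_pair_eqP x y (M - 1) M.
  have := emin _ _ AM1 AM; lia.
have next1 u : A u -> A u.+1 -> u.+1 <> M -> False.
  move=> Au Au1 ne; have := emin _ _ Au Au1; lia.
have nM2 : ~ A (M - 2).
  move=> h; apply: (next1 _ h); last lia.
  by rewrite (_ : (M - 2).+1 = M - 1) //; lia.
(* A difference [M - 2] starts at some [u >= k >= 2] and ends at most at [M], so [u = k = 2]. *)
have [ek A2] : k = 2 /\ A 2.
  have [|//|[u [v [Au Av _ _ e]]]] := onto (M - 2); first lia.
  have [/rng Hu /rng Hv] := (Au, Av).
  by have <- : u = 2 by [lia]; split=> //; lia.
have nM3 : ~ A (M - 3).
  by have := enew _ _ A2 AM1; rewrite (_ : M - 1 - 2 = M - 3); [apply|]; lia.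
have n3 : ~ A 3 by move=> h; apply: (next1 _ A2 h); lia.
have n4 : ~ A 4.
  by move=> h; apply: (enew _ _ A2 h) => //; lia.
have AM4 : A (M - 4).
  have [|//|[u [v [Au Av _ _ e]]]] := onto (M - 4); first lia.
  have [/rng Hu /rng Hv] := (Au, Av).
  have [e2|[e3|e4]] : u = 2 \/ (u = 3 \/ u = 4) by lia.
  - by case: nM2; rewrite (_ : M - 2 = v) //; lia.
  - by case: n3; rewrite -e3.
  - by case: n4; rewrite -e4.
have [|h|[u [v [Au Av _ _ e]]]] := onto (M - 5); first lia.
  apply: (next1 _ h); last lia.
  by rewrite (_ : (M - 5).+1 = M - 4) //; lia.
have [/rng Hu /rng Hv] := (Au, Av).
have [e2|[e3|[e4|e5]]] : u = 2 \/ (u = 3 \/ (u = 4 \/ u = 5)) by lia.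
- by case: nM3; rewrite (_ : M - 3 = v) //; lia.
- by case: n3; rewrite -e3.
- by case: n4; rewrite -e4.
(* The differences [5 - 2] and [(M - 1) - (M - 4)] are both [3], against injectivity on edges. *)
- have A5 : A 5 by rewrite -e5.
  by have := einj _ _ _ _ A2 A5 isT _ AM4 AM1; lia.
Qed.

(* Adjoining the mark [0] turns the vertex labels themselves into distances. *)
Lemma label_set_ruler M x y A : 14 <= M -> y <= M -> ~ label_set 1 M x y A.
Proof.
move=> M14 yM lA; have AM : A M by apply: label_max lA; lia.
case: lA => rng _ enew einj onto.
pose B := [pred n | (n == 0) || A n].
apply: (@no_ruler_repeating_once B M x y) => //=; last by rewrite AM orbT.
- have pos n : A n -> 0 < n by move/rng => /andP[].
  move=> a b c d /= /orP[/eqP ea|Aa] /orP[/eqP eb|Ab] /orP[/eqP ec|Ac]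
    /orP[/eqP ed|Ad] ab cd ac e; try lia.
  (* At most one of [a], [c] is [0]. If one is, an edge difference would equal a vertex label unless
     its pair is [(x, y)]; if neither is, two edge labels would coincide. *)
  + right; have [//|ne] := nat_pair_eqP c d x y; case: (enew _ _ Ac Ad cd ne).
    by rewrite (_ : d - c = b) //; lia.
  + left; have [//|ne] := nat_pair_eqP a b x y; case: (enew _ _ Aa Ab ab ne).
    by rewrite (_ : b - a = d) //; lia.
  + have [|ne] := nat_pair_eqP a b x y; first by left.
    have [|ne'] := nat_pair_eqP c d x y; first by right.
    by have := einj _ _ _ _ Aa Ab ab ne Ac Ad cd ne'; lia.
- move=> l lM; have [|Al|[u [v [Au Av _ _ e]]]] := onto l; first lia.
    by exists 0, l; split=> //=; [rewrite Al orbT|lia].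
  exists u, v; split=> //=; rewrite ?Au ?Av ?orbT //.
  by have /andP[] := rng _ Av.
Qed.

(** * Graph labelings *)

Lemma edgesP (G : sgraph) (A : {set vertex G}) :
  reflect (exists u v, adj u v /\ A = [set u; v]) (A \in edges G).
Proof.
apply: (iffP imset2P) => [[u v _] | [u [v [uv ->]]]].
  by rewrite inE => /andP[_ uv] ->; exists u, v.
by exists u v; rewrite ?inE.
Qed.

Lemma adj_edge (G : sgraph) (u v : vertex G) :
  adj u v -> exists e : edge G, val e = [set u; v].
Proof.
move=> uv; have Huv : [set u; v] \in edges G by apply/edgesP; exists u, v.
by exists (exist (fun A => is_true (A \in edges G)) _ Huv).
Qed.

Lemma set2_inj (T : finType) (u v x y : T) : [set u; v] = [set x; y] ->
  (u = x /\ v = y) \/ (u = y /\ v = x).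
Proof.
move=> e.
have /set2P Hu : u \in [set x; y] by rewrite -e set21.
have /set2P Hv : v \in [set x; y] by rewrite -e set22.
have /set2P Hx : x \in [set u; v] by rewrite e set21.
have /set2P Hy : y \in [set u; v] by rewrite e set22.
case: Hu => ?; case: Hv => ?; subst; auto; left; split=> //.
  by case: Hy.
by case: Hx.
Qed.

Definition complete_minus_edge (G : sgraph) (x y : vertex G) : Prop :=
  forall u v, adj u v = (u != v) && ([set u; v] != [set x; y]).

Lemma super_graceful_label_set (G : sgraph) (x0 y0 : vertex G) (k : nat) :
  complete_minus_edge x0 y0 -> super_graceful k G ->
  exists A x y, y <= k + gorder G + gsize G - 1 /\
    label_set k (k + gorder G + gsize G - 1) x y A.
Proof.
move=> Gxy [f [[g fK gK] fE]]; set M := k + _ + _ - 1 in f g fK gK fE *.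
pose lab u := val (f (inl u)).
have lab_rng u : k <= lab u <= M by exact: (valP (f (inl u))).
have lab_inj : injective lab by move=> u v /val_inj /(can_inj fK) [].
have adj_dist u v : adj u v -> lab u < lab v ->
    exists2 e : edge G, val e = [set u; v] & val (f (inr e)) = lab v - lab u.
  move=> uv luv; have [e eE] := adj_edge uv; exists e => //.
  by rewrite (fE _ _ _ eE) -/(lab u) -/(lab v); lia.
(* The labels of the non-adjacent vertices are sorted, since a label set only compares pairs
   [u < v]. *)
pose x := minn (lab x0) (lab y0); pose y := maxn (lab x0) (lab y0).
have nonadj u v : lab u < lab v ->
    [set u; v] = [set x0; y0] <-> lab u = x /\ lab v = y.
  move=> luv; split=> [/set2_inj H|[eu ev]].
    by case: H luv => -[-> ->]; rewrite /x /y; lia.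
  have [[a b]|[a b]] : (lab u = lab x0 /\ lab v = lab y0) \/
      (lab u = lab y0 /\ lab v = lab x0) by rewrite /x /y in eu ev; lia.
    by rewrite (lab_inj _ _ a) (lab_inj _ _ b).
  by rewrite (lab_inj _ _ a) (lab_inj _ _ b) setUC.
have adjP u v : lab u < lab v -> ~ (lab u = x /\ lab v = y) -> adj u v.
  move=> luv ne; rewrite Gxy; apply/andP; split.
    by apply/eqP => e; move: luv; rewrite e ltnn.
  by apply/eqP => /(nonadj _ _ luv).
pose A n := [exists u, lab u == n].
have AP n : reflect (exists u, lab u = n) (A n).
  by apply: (iffP existsP) => -[u /eqP]; exists u => //; apply/eqP.
exists A, x, y; split.
  have := lab_rng x0; have := lab_rng y0; rewrite /y; lia.
split.
- by move=> n /AP[u <-].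
- move=> _ _ /AP[u <-] /AP[v <-] luv /(adjP _ _ luv) uv.
  have [e _ <-] := adj_dist _ _ uv luv; by have /andP[] := valP (f (inr e)).
- move=> _ _ /AP[u <-] /AP[v <-] luv /(adjP _ _ luv) uv /AP[w].
  by have [e _ <-] := adj_dist _ _ uv luv => /val_inj /(can_inj fK).
- move=> _ _ _ _ /AP[u <-] /AP[v <-] luv /(adjP _ _ luv) uv
    /AP[u' <-] /AP[v' <-] luv' /(adjP _ _ luv') uv'.
  have [e eE <-] := adj_dist _ _ uv luv; have [e' eE' <-] := adj_dist _ _ uv' luv'.
  move=> /val_inj /(can_inj fK) [ee]; move: eE; rewrite ee eE' => /set2_inj.
  by case=> -[eu ev]; rewrite eu ev // in luv luv' *; lia.
- move=> l lM; have := gK (exist (fun n => is_true (k <= n <= M)) l lM); case: (g _) => [u|e] fl.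
    by left; apply/AP; exists u; rewrite /lab fl.
  right; have /edgesP[u [v [uv eE]]] := valP e.
  wlog luv : u v uv eE / lab u < lab v.
    move=> H; have [ | |/lab_inj euv] := ltngtP (lab u) (lab v).
    - exact: H.
    - by apply: H; [rewrite adj_sym | rewrite setUC].
    - by move: uv; rewrite euv adj_irr.
  exists (lab u), (lab v); split=> //; try by apply/AP; eexists.
    by move/(nonadj _ _ luv) => e2; move: uv; rewrite Gxy e2 eqxx andbF.
  have := fE _ _ _ eE; rewrite fl /= -/(lab u) -/(lab v); lia.
Qed.

(** The edges are all two-element sets of vertices except [[set x; y]]. *)
Lemma gsize_complete_minus_edge (G : sgraph) (x y : vertex G) :
  x != y -> complete_minus_edge x y -> (gsize G).+1 = 'C(gorder G, 2).
Proof.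
move=> xy Gxy; rewrite /gsize /gorder -card_draws.
rewrite (cardsD1 [set x; y]) inE cards2 xy add1n; congr _.+1.
apply: eq_card => A; rewrite !inE; apply/edgesP/andP.
  move=> [u [v [+ ->]]]; rewrite Gxy => /andP[uv ->].
  by rewrite cards2 uv.
by move=> [nA /cards2P[u [v [uv eA]]]]; exists u, v; rewrite Gxy uv -eA.
Qed.

Lemma surjective_bijective (T : choiceType) (S : eqType) (f : T -> S) :
  injective f -> (forall y, exists x, f x == y) -> bijective f.
Proof.
move=> f_inj f_onto; have gK y := eqP (xchooseP (f_onto y)).
by exists (fun y => xchoose (f_onto y)) => // x; apply: f_inj; rewrite gK.
Qed.

(** Vertex labels determine the edge labels, so a labeling can be specified by [lab] alone. *)
Lemma super_graceful_intro (G : sgraph) (k M : nat) (lab : vertex G -> nat) :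
  M = k + gorder G + gsize G - 1 -> injective lab ->
  (forall u, k <= lab u <= M) ->
  (forall u v, adj u v -> k <= `|lab u - lab v|%N <= M) ->
  (forall u v w, adj u v -> lab w <> `|lab u - lab v|%N) ->
  (forall u v u' v', adj u v -> adj u' v' ->
     `|lab u - lab v|%N = `|lab u' - lab v'|%N -> [set u; v] = [set u'; v']) ->
  (forall l, k <= l <= M ->
     (exists u, lab u = l) \/ exists u v, adj u v /\ `|lab u - lab v|%N = l) ->
  super_graceful k G.
Proof.
move=> ->; rewrite /super_graceful; set N := k + _ + _ - 1.
move=> lab_inj lab_rng erng enew einj onto.
(* An edge is an unordered set; the maximal distance between its elements gives its label without
   choosing an order of the ends. *)
pose elab (A : {set vertex G}) :=
  \max_(u in A) \max_(v in A) `|lab u - lab v|%N.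
have elabE u v : u != v -> elab [set u; v] = `|lab u - lab v|%N.
  move=> uv; have nuv : u \notin [set v] by rewrite inE.
  rewrite /elab !(big_setU1 _ nuv) !big_set1 /=.
  by rewrite !(big_setU1 _ nuv) !big_set1 /=; lia.
have adj_neq u v : adj u v -> u != v :> vertex G.
  by move=> uv; apply/eqP => e; move: uv; rewrite e adj_irr.
have elab_rng (e : edge G) : k <= elab (val e) <= N.
  have /edgesP[u [v [uv ->]]] := valP e.
  by rewrite elabE ?erng // adj_neq.
pose f (z : vertex G + edge G) : nat_interval k N := match z with
  | inl u => exist (fun n => is_true (k <= n <= N)) (lab u) (lab_rng u)
  | inr e => exist (fun n => is_true (k <= n <= N)) (elab (val e)) (elab_rng e)
  end.
exists f; split.
  apply: (@surjective_bijective (vertex G + {A : {set vertex G} | A \in edges G})%type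
            {n : nat | k <= n <= N}).
    move=> [u|e] [u'|e'] /(congr1 val) /=.
    - by move/lab_inj ->.
    - have /edgesP[u1 [v1 [uv ->]]] := valP e'.
      by rewrite elabE ?adj_neq // => /enew; case.
    - have /edgesP[u1 [v1 [uv ->]]] := valP e.
      by rewrite elabE ?adj_neq // => /esym/enew; case.
    - have /edgesP[u1 [v1 [uv eE]]] := valP e.
      have /edgesP[u2 [v2 [uv' eE']]] := valP e'.
      rewrite eE eE' !elabE ?adj_neq // => /(einj _ _ _ _ uv uv') ee.
      by congr inr; apply: val_inj; rewrite /= eE eE'.
  move=> [l lN]; have [[u ul]|[u [v [uv ul]]]] := onto l lN.
    by exists (inl u); apply/eqP/val_inj.
  have [e eE] := adj_edge uv; exists (inr e); apply/eqP/val_inj.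
  by rewrite /= eE elabE ?adj_neq.
move=> u v e eE; rewrite /= eE elabE //.
have /edgesP[u1 [v1 [uv]]] := valP e; rewrite eE => /set2_inj[][-> ->].
  exact: adj_neq.
by rewrite eq_sym; exact: adj_neq.
Qed.

(** * The graph K(1, ..., 1, 2) *)

Section CompleteMinusEdge.

Variable r : nat.
Let s := rcons (nseq r 1) 2.

Let lt_r : r < size s. Proof. by rewrite size_rcons size_nseq. Qed.
Let part_r : nth 0 s r = 2.
Proof. by rewrite nth_rcons size_nseq ltnn eqxx. Qed.

Lemma part1 (i : 'I_(size s)) : i != r :> nat -> nth 0 s i = 1.
Proof.
move=> ir; have := ltn_ord i; rewrite [X in _ < X]size_rcons size_nseq ltnS => ile.
have ilt : i < r by lia.
by rewrite nth_rcons size_nseq ilt nth_nseq ilt.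
Qed.

Let lt0 : 0 < nth 0 s (Ordinal lt_r). Proof. by rewrite /= part_r. Qed.
Let lt1 : 1 < nth 0 s (Ordinal lt_r). Proof. by rewrite /= part_r. Qed.

Definition twin0 : vertex (complete_multipartite s) :=
  Tagged (fun i : 'I_(size s) => 'I_(nth 0 s i)) (Ordinal lt0).
Definition twin1 : vertex (complete_multipartite s) :=
  Tagged (fun i : 'I_(size s) => 'I_(nth 0 s i)) (Ordinal lt1).

Lemma twins_neq : twin0 != twin1.
Proof. by rewrite eq_Tagged. Qed.

Lemma twinsP (v : vertex (complete_multipartite s)) :
  tag v = r :> nat -> v = twin0 \/ v = twin1.
Proof.
case: v => i a /= ir; have ei : i = Ordinal lt_r by apply: val_inj.
move: a; rewrite ei => a; have := ltn_ord a; rewrite [X in _ < X]part_r.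
case ea: (nat_of_ord a) => [|[|//]] _; [left | right].
  by congr existT; apply: val_inj.
by congr existT; apply: val_inj.
Qed.

(** Every part other than part [r] is a singleton, so distinct vertices in a common part are the two
    twins. *)
Lemma complete_multipartite_minus_edge : complete_minus_edge twin0 twin1.
Proof.
move=> u v; rewrite /= /mpart_adj; apply/idP/andP => [uv|[uv ne]].
  split; first by apply: contra uv => /eqP ->.
  by apply: contra uv => /eqP /set2_inj[][-> ->].
apply/eqP => euv; have [ur|ur] := eqVneq (tag u : nat) r.
  have vr : tag v = r :> nat by rewrite -euv.
  have [eu|eu] := twinsP ur; have [ev|ev] := twinsP vr;
    move: uv ne; rewrite eu ev ?eqxx // => _.
  by rewrite setUC eqxx.
case/negP: uv; case: u v euv ur {ne} => i a [j b] /= eij; subst j => ir.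
rewrite eq_Tagged /=; apply/eqP/val_inj => /=.
move: (ltn_ord a) (ltn_ord b); rewrite [X in a < X -> _]part1 //.
rewrite [X in _ -> b < X -> _]part1 //.
by case: (nat_of_ord a) (nat_of_ord b) => [|?] [|?].
Qed.

Lemma gorder_complete_multipartite : gorder (complete_multipartite s) = r.+2.
Proof.
rewrite /gorder /= card_tagged.
rewrite (_ : map _ _ = s); last first.
  rewrite -[RHS](mkseq_nth 0) /mkseq -val_enum_ord -map_comp.
  by apply: eq_map => i; rewrite card_ord.
by rewrite sumn_rcons sumn_nseq; lia.
Qed.

End CompleteMinusEdge.

Lemma super_graceful_112 :
  super_graceful 1 (complete_multipartite (rcons (nseq 2 1) 2)).
Proof.
set G := complete_multipartite _.
pose lab (u : vertex G) : nat :=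
  (* The singleton parts get [6] and [9]; the two vertices of the last part get [1] and [2]. *)
  nth 0 [:: 6; 9; (tagged u).+1] (tag u).
have lab_mem u : lab u \in [:: 1; 2; 6; 9].
  by case: u => -[[|[|[|//]]] ?] [[|[|?]] ?].
(* Adjacency is read off the labels, which turns the conditions on edges into finite checks on
   [1, 2, 6, 9]. *)
have adjE u v : adj u v = (lab u != lab v) && ((2 < lab u) || (2 < lab v)).
  by case: u => -[[|[|[|//]]] ?] [[|[|?]] ?];
     case: v => -[[|[|[|//]]] ?] [[|[|?]] ?].
have lab_inj : injective lab.
  move=> u v; case: u => -[[|[|[|//]]] Hi] [[|[|?]] Hu] //;
    case: v => -[[|[|[|//]]] Hj] [[|[|?]] Hv] // _;
    move: Hu Hv; rewrite (bool_irrelevance Hi Hj) => Hu Hv;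
    by rewrite (bool_irrelevance Hu Hv).
have onto n : n \in [:: 1; 2; 6; 9] -> exists u, lab u = n.
  have i0 : 0 < size (rcons (nseq 2 1) 2) by [].
  have i1 : 1 < size (rcons (nseq 2 1) 2) by [].
  have i2 : 2 < size (rcons (nseq 2 1) 2) by [].
  pose T (i : 'I_(size (rcons (nseq 2 1) 2))) := 'I_(nth 0 (rcons (nseq 2 1) 2) i).
  have j0 : 0 < nth 0 (rcons (nseq 2 1) 2) (Ordinal i0) by [].
  have j1 : 0 < nth 0 (rcons (nseq 2 1) 2) (Ordinal i1) by [].
  rewrite !inE => /or4P[] /eqP ->.
  - by exists (twin0 2).
  - by exists (twin1 2).
  - by exists (existT T (Ordinal i0) (Ordinal j0)).
  - by exists (existT T (Ordinal i1) (Ordinal j1)).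
have gsz : (gsize G).+1 = 'C(4, 2).
  rewrite (gsize_complete_minus_edge (twins_neq 2)).
    by rewrite gorder_complete_multipartite.
  exact: complete_multipartite_minus_edge.
apply: (@super_graceful_intro G 1 9 lab) => //.
- by rewrite gorder_complete_multipartite; move: gsz; rewrite (_ : 'C(4, 2) = 6) //; lia.
- by move=> u; have := lab_mem u; rewrite !inE; lia.
- move=> u v; have := lab_mem u; have := lab_mem v; rewrite adjE !inE; lia.
- move=> u v w; have := lab_mem u; have := lab_mem v; have := lab_mem w.
  rewrite adjE !inE.
  move=> /or4P[] /eqP -> /or4P[] /eqP -> /or4P[] /eqP -> //.
- move=> u v u' v'; rewrite !adjE => uv uv' e.
  have [[a b]|[a b]] : (lab u = lab u' /\ lab v = lab v') \/
      (lab u = lab v' /\ lab v = lab u').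
    move: (lab_mem u) (lab_mem v) (lab_mem u') (lab_mem v') uv uv' e; rewrite !inE.
    by move=> /or4P[] /eqP -> /or4P[] /eqP -> /or4P[] /eqP -> /or4P[] /eqP -> //;
      auto.
  + by rewrite (lab_inj _ _ a) (lab_inj _ _ b).
  + by rewrite (lab_inj _ _ a) (lab_inj _ _ b) setUC.
- move=> l l9.
  have pick a b : a \in [:: 1; 2; 6; 9] -> b \in [:: 1; 2; 6; 9] ->
      (a != b) && ((2 < a) || (2 < b)) -> `|a - b|%N = l ->
      exists u v, adj u v /\ `|lab u - lab v|%N = l.
    by move=> /onto[u <-] /onto[v <-] uv e; exists u, v; rewrite adjE.
  have [/onto|nl] := boolP (l \in [:: 1; 2; 6; 9]); first by left.
  right; move: l l9 nl pick => [|[|[|[|[|[|[|[|[|[|//]]]]]]]]]] // _ _ pick.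
  + exact: (pick 9 6).
  + exact: (pick 6 2).
  + exact: (pick 6 1).
  + exact: (pick 9 2).
  + exact: (pick 9 1).
Qed.

Theorem theorem4p8 (r k : nat) (hr : 2 <= r) (hk : 1 <= k) :
  super_graceful k (complete_multipartite (rcons (nseq r 1) 2)) <->
  r = 2 /\ k = 1.
Proof.
split=> [|[-> ->]]; last exact: super_graceful_112.
have Gxy := @complete_multipartite_minus_edge r.
have := gsize_complete_minus_edge (twins_neq r) Gxy.
move=> + /(super_graceful_label_set Gxy) [A [x [y []]]].
rewrite gorder_complete_multipartite; set q := gsize _; set M := k + _ + _ - 1.
move=> eq yM lA.
(* From [r >= 2], [q + 1] is at least ['C(4, 2) = 6]; order at least [4] then gives [M >= k + 8]. *)
have q5 : 5 <= q.
  by rewrite -ltnS eq (@leq_trans 'C(4, 2)) // leq_bin2l.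
have k1 : k = 1 by apply: label_set_k1 lA => //; rewrite /M; lia.
split=> //; apply/eqP; rewrite eqn_leq hr andbT leqNgt; apply/negP => r3.
(* From [r >= 3], [q + 1] is at least ['C(5, 2) = 10]; with order at least [5] and [k = 1], this
   gives [M >= 14]. *)
have q9 : 9 <= q.
  by rewrite -ltnS eq (@leq_trans 'C(5, 2)) // leq_bin2l.
rewrite k1 in lA; apply: label_set_ruler lA => //; rewrite /M; lia.
Qed.
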